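(* Let $q$ be a prime power, $F$ a field of characteristic $p>0$ not dividing $q$, $m=m(p,q)$ and $n\ge0$. For all $(k,i)$ with $0<i<m$ the sequence $\mathcal{M}^n_{k,i}$ is almost exact. Furthermore, $\mathcal{M}^n_{k,i}$ is exact if and only if $(k,i)\sim(k',i')$ implies that $(k',i')$ is not a middle index for $n$.
   Context: For $i\ge 1$ put $[i]_q=1+q+\dots+q^{i-1}$, and let $m=m(p,q):=\min\{i>1 : [i]_q=0 \text{ in } F\}$. For integers $n\ge 0$ and $k$ let $L^n_k$ be the set of $k$-dimensional subspaces of $\mathbb{F}_q^n$ and let $M^n_k=FL^n_k$ be the $F$-vector space with basis $L^n_k$ ($M^n_k=0$ if $k<0$ or $k>n$). The incidence map $\partial:M^n_k\to M^n_{k-1}$ is the linear map sending $x\in L^n_k$ to the sum of all $(k-1)$-dimensional subspaces of $x$. One has $\partial^m=0$. For $0<i<m$, $\mathcal{M}^n_{k,i}$ is the chain complex $$\cdots\leftarrow M^n_{k-m}\xleftarrow{\partial^{m-i}} M^n_{k-i}\xleftarrow{\partial^{i}} M^n_{k}\xleftarrow{\partial^{m-i}} M^n_{k+m-i}\xleftarrow{\partial^{i}} M^n_{k+m}\leftarrow\cdots .$$ Such a complex is almost exact if all but at most one of its homology modules vanish. Write $(k,i)\sim(k',i')$ if $\mathcal{M}^n_{k,i}=\mathcal{M}^n_{k',i'}$ as sequences; for instance, $(k,i)$, $(k-i,m-i)$ and $(k\pm m,i)$ all define the same sequence. A pair of integers $(k,i)$ is a middle index for $n$ if $0\le k\le n$,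 $0<i<m$ and $n<2k+m-i<n+m$. *)

(* Defs.v *)
From HB Require Import structures.
From mathcomp Require Import all_boot all_order all_algebra.

Set Implicit Arguments.
Unset Strict Implicit.
Unset Printing Implicit Defensive.

Import Order.TTheory GRing.Theory Num.Theory.
Local Open Scope ring_scope.

Section QuantumCharacteristic.
Variable F : fieldType.

Definition qint (q i : nat) : F := \sum_(j < i) q%:R ^+ j.

Lemma qint_eq0_exists (p q : nat) :
  p \in [pchar F] -> ~~ (p %| q)%N ->
  exists i, (1 < i)%N && (qint q i == 0).
Proof.
move=> pF npq; have p_pr := pcharf_prime pF.
have p_gt1 := prime_gt1 p_pr.
have q_fermat : (q%:R : F) ^+ p.-1 = 1.
  have q_nz : (q%:R : F) != 0 by rewrite -(dvdn_pcharf pF).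
  apply: (mulfI q_nz); rewrite -exprS prednK ?prime_gt0 // mulr1.
  exact: (pFrobenius_aut_nat pF q).
exists (p.-1 * p)%N; apply/andP; split.
  by case: p p_gt1 {pF npq p_pr q_fermat} => [|[|p]] // _; rewrite mulnS ltn_addr.
have block b : qint q (p.-1 * b) = qint q p.-1 *+ b.
  elim: b => [|b IHb]; first by rewrite muln0 /qint big_ord0 mulr0n.
  rewrite mulnSr mulrSr -IHb /qint big_split_ord /=; congr (_ + _).
  by apply: eq_bigr => j _; rewrite exprD exprM q_fermat expr1n mul1r.
by rewrite block -mulr_natr (pcharf0 pF) mulr0.
Qed.

Definition qchar (p q : nat) (pF : p \in [pchar F]) (npq : ~~ (p %| q)%N) : nat :=
  ex_minn (qint_eq0_exists pF npq).

End QuantumCharacteristic.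

Definition subsp (K : finFieldType) (n : nat) : predArgType := {vspace 'rV[K]_n}.
HB.instance Definition _ (K : finFieldType) (n : nat) := SubChoice.on (subsp K n).
HB.instance Definition _ (K : finFieldType) (n : nat) :=
  [Countable of subsp K n by <:].
HB.instance Definition _ (K : finFieldType) (n : nat) :=
  [Finite of subsp K n by <:].

(* The vector space over F with basis the set of all subspaces of K^n. It is   *)
(* the direct sum of all M^n_k, so that all terms of a sequence below are      *)
(* subspaces of it and the incidence maps restrict one endomorphism.           *)
Definition FL (F : fieldType) (K : finFieldType) (n : nat) : vectType F :=
  {ffun subsp K n -> F^o}.

Section Incidence.
Variables (F : fieldType) (K : finFieldType) (n : nat).

Definition basis_elt (x : subsp K n) : FL F K n := [ffun y => (y == x)%:R].

Definition M (k : int) : {vspace FL F K n} :=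
  <<[seq basis_elt x | x in [pred x : subsp K n | (\dim x)%:Z == k]]>>%VS.

Definition incidence_fun (f : FL F K n) : FL F K n :=
  \sum_x f x *: \sum_(y : subsp K n | (y <= x)%VS && ((\dim y).+1 == \dim x))
                  basis_elt y.

Fact incidence_fun_is_linear : linear incidence_fun.
Proof.
move=> a f g; rewrite /incidence_fun scaler_sumr -big_split /=.
by apply: eq_bigr => x _; rewrite !ffunE scalerDl scalerA.
Qed.
HB.instance Definition _ := GRing.isLinear.Build F (FL F K n) (FL F K n) _
  incidence_fun incidence_fun_is_linear.

Definition incidence : 'End(FL F K n) := linfun incidence_fun.

Definition incidence_pow (d : nat) : 'End(FL F K n) :=
  iter d (comp_lfun incidence) \1%VF.

End Incidence.

(* A doubly infinite sequence of subspaces of V; the map out of the term in    *)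
(* position t is the restriction of [smap t], and goes to the term in position *)
(* t - 1.                                                                      *)
Record vseq (F : fieldType) (V : vectType F) := VSeq {
  term : int -> {vspace V};
  smap : int -> 'End(V)
}.

Section Sequences.
Variables (F : fieldType) (V : vectType F).
Implicit Types C D : vseq V.

Definition cycles C (t : int) : {vspace V} := (term C t :&: lker (smap C t))%VS.
Definition boundaries C (t : int) : {vspace V} := (smap C (t + 1) @: term C (t + 1))%VS.

Definition exact_at C (t : int) : Prop := cycles C t = boundaries C t.

Definition exact_seq C : Prop := forall t, exact_at C t.

Definition almost_exact C : Prop :=
  forall t1 t2, ~ exact_at C t1 -> ~ exact_at C t2 -> t1 = t2.

(* The sequences carry no distinguished position, hence the shift s. *)
Definition same_seq C D : Prop :=
  exists s : int, forall t : int,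
    term C t = term D (t + s) /\ {in term C t, smap C t =1 smap D (t + s)}.

End Sequences.

Section IncidenceSequence.
Variables (F : fieldType) (K : finFieldType) (n m : nat).

(* The dimensions occurring are k + s m in position 2 s and k + s m + (m - i)  *)
(* in position 2 s + 1.                                                        *)
Definition Mseq_dim (k : int) (i : nat) (t : int) : int :=
  k + (t %/ 2)%Z * m%:Z + (if (2 %| t)%Z then 0 else m%:Z - i%:Z).

Definition Mseq_pow (i : nat) (t : int) : nat :=
  if (2 %| t)%Z then i else (m - i)%N.

Definition Mseq (k : int) (i : nat) : vseq (FL F K n) :=
  VSeq (fun t => M F K n (Mseq_dim k i t))
       (fun t => incidence_pow F K n (Mseq_pow i t)).

End IncidenceSequence.

Definition middle_index (m n : nat) (k : int) (i : nat) : Prop :=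
  [/\ 0 <= k <= n%:Z, (0 < i < m)%N &
      n%:Z < k *+ 2 + m%:Z - i%:Z < n%:Z + m%:Z].

(* Main.v *)
From HB Require Import structures.
Require Import Defs.
From mathcomp Require Import all_boot all_order all_algebra.
From mathcomp Require Import finfield zify ring.
Import Order.TTheory GRing.Theory Num.Theory.
Local Open Scope ring_scope.
Set Implicit Arguments.
Unset Strict Implicit.
Unset Printing Implicit Defensive.

(** Induction on the dimension of W = H + <e>, H a hyperplane of W. The group of
    transvections of W with axis H has order prime to p. Its average splits off
    the part of M(W) that consists of all a + avg b with a, b in M(H), on which the
    incidence map is (a, b) |-> (d a + b, q d b): this is a mapping cone. Its
    exactness outside the middle range of W follows from that for H, and in
    the two boundary degrees the connecting map is an isomorphism for formal
    reasons. The complement is a sum, over hyperplanes B of H, of copies of M(B)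
    with dimensions shifted by one and d replaced by q d, so dim W drops by 2
    and the middle range is preserved. These copies are direct summands, which also
    carries nonvanishing homology from B to W; at the two extreme dimensions
    the homology is nonzero because the neighbouring terms vanish. *)

Definition facet (K : finFieldType) (n : nat) (x : subsp K n) : pred (subsp K n) :=
  fun y => (y <= x)%VS && ((\dim y).+1 == \dim x).

(** * Hyperplanes *)

Section Subspaces.
Variables (K : fieldType) (vT : vectType K).
Implicit Types (x y w H : {vspace vT}) (u v h : vT).

Lemma dimv_addline y u : u \notin y -> \dim (y + <[u]>) = (\dim y).+1.
Proof.
move=> uy; rewrite dimv_disjoint_sum ?dim_vline.
  by case: eqVneq uy => [-> | _]; rewrite ?mem0v // addn1.
apply/eqP; rewrite -subv0; apply/subvP => v; rewrite memv_cap => /andP[vy].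
case/vlineP=> a va; move: vy; rewrite memv0 va rpredZeq (negPf uy) orbF => /eqP->.
by rewrite scale0r.
Qed.

Lemma mem_addline y u v : reflect (exists a, v - a *: u \in y) (v \in y + <[u]>)%VS.
Proof.
apply: (iffP memv_addP) => [[y' y'y [v' /vlineP[a ->] ->]]|[a va]].
  by exists a; rewrite addrK.
by exists (v - a *: u) => //; exists (a *: u); rewrite ?subrK // memvZ ?memv_line.
Qed.

Lemma capv_addline y H u : (y <= H)%VS -> u \notin H -> ((y + <[u]>) :&: H)%VS = y.
Proof.
move=> yH uH; apply/eqP; rewrite eqEsubv subv_cap addvSl yH !andbT.
apply/subvP=> v; rewrite memv_cap => /andP[/mem_addline[a vy] vH].
have [a0 | a0] := eqVneq a 0; first by rewrite a0 scale0r subr0 in vy.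
have: a *: u \in H by rewrite -(subKr v (a *: u)) rpredB // (subvP yH).
by rewrite (rpredZeq) (negPf a0) (negPf uH).
Qed.

(** A subspace of [H + <[u]>] not inside [H] is given by its trace on [H] and by a shift of [u]
    modulo that trace. This is the order in these coordinates. *)
Lemma addlineS y w H u h : (y <= H)%VS -> (w <= H)%VS -> u \notin H -> h \in H ->
  (w + <[u + h]> <= y + <[u]>)%VS = (w <= y)%VS && (h \in y).
Proof.
move=> yH wH uH hH; apply/idP/andP => [|[wy hy]].
  rewrite subv_add => /andP[wyu uyu]; split.
    by rewrite -(capv_addline yH uH) subv_cap wyu.
  rewrite -(capv_addline yH uH) memv_cap hH andbT -(addKr u h) addrC.
  by rewrite memvB // ?memvE // (subv_trans _ (addvSr _ _)).
rewrite subv_add (subv_trans wy) ?addvSl //= -memvE memvD //.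
  by rewrite (subvP (addvSr _ _)) ?memv_line.
by rewrite (subvP (addvSl _ _)).
Qed.

Lemma notin_shift H u h : h \in H -> (u + h \notin H) = (u \notin H).
Proof. by move=> hH; rewrite rpredDr. Qed.

Lemma dimv_addline_notin y H u : (y <= H)%VS -> u \notin H ->
  \dim (y + <[u]>) = (\dim y).+1.
Proof. by move=> yH uH; apply: dimv_addline; apply: contra uH; apply: (subvP yH). Qed.

Lemma addline_shift y H u h : (y <= H)%VS -> u \notin H -> h \in y ->
  (y + <[u + h]>)%VS = (y + <[u]>)%VS.
Proof.
move=> yH uH hy; have hH := subvP yH h hy.
apply/eqP; rewrite eqEdim (addlineS yH yH uH hH) subvv hy /=.
by rewrite !(dimv_addline_notin yH) ?leqnn ?notin_shift.
Qed.

Lemma not_sub_addline y H u : u \notin H -> ~~ (y + <[u]> <= H)%VS.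
Proof. by apply: contra => /subvP; apply; rewrite (subvP (addvSr _ _)) ?memv_line. Qed.

Lemma addline_split x H u : (x <= H + <[u]>)%VS -> ~~ (x <= H)%VS ->
  exists2 h, h \in H & x = ((x :&: H) + <[u + h]>)%VS.
Proof.
move=> xHu /subvPn[v vx vH]; have /mem_addline[a vuH] := subvP xHu v vx.
have a0 : a != 0 by apply: contraNneq vH => a0; rewrite a0 scale0r subr0 in vuH.
(* The multiple of [v] with [u]-coefficient 1 still lies in [x]; [h] is its part in [H]. *)
exists (a^-1 *: v - u); first by rewrite -[u](scalerK a0) -scalerBr memvZ.
rewrite addrC subrK; apply/eqP; rewrite eqEsubv subv_add capvSl -memvE memvZ // !andbT.
apply/subvP=> w wx; have /mem_addline[b wuH] := subvP xHu w wx.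
apply/mem_addline; exists b; rewrite memv_cap rpredB ?memvZ //=.
suff -> : w - b *: (a^-1 *: v) = w - b *: u - (b * a^-1) *: (v - a *: u).
  by rewrite rpredB ?memvZ.
by rewrite !scalerBr !scalerA mulfVK // opprB addrA subrK.
Qed.

End Subspaces.

(** * Counting the hyperplanes above a given subspace *)

Section Counting.
Variables (K : finFieldType) (n : nat).
Implicit Types (x y z w B C H : subsp K n) (u v : 'rV[K]_n).
Local Notation q := #|K|.

Lemma card_subsp (V : {vspace 'rV[K]_n}) : #|[pred v | v \in V]| = (q ^ \dim V)%N.
Proof. by rewrite -(@card_vspace _ _ (Vector.class 'rV[K]_n) V); apply: eq_card. Qed.

Lemma cardK_gt1 : (1 < q)%N.
Proof. exact: finNzRing_gt1. Qed.

(** Induction on the codimension: a vector [v] outside [z] enlarges [z] to [z + <[v]>], to which the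
    induction hypothesis applies. *)
Lemma card_hyperplanes_above H z : (z <= H)%VS ->
  ((q - 1) * #|[pred B : subsp K n | facet H B && (z <= B)%VS]| + 1 = q ^ (\dim H - \dim z))%N.
Proof.
have q1 := cardK_gt1.
move dE: (\dim H - \dim z)%N => d; elim: d z dE => [|d IHd] z dE zH.
  have zE: z = H by apply/eqP; rewrite eqEdim zH /=; lia.
  have -> : #|[pred B : subsp K n | facet H B && (z <= B)%VS]| = 0%N.
    apply: eq_card0 => B; rewrite !inE zE; apply/negP => /andP[/andP[BH dB] /dimvS].
    by move: dB; lia.
  by rewrite muln0.
(* When [d] is 0, [z] has codimension 1 and the double count below would read 0 = 0, since its
   factor [q ^ d - 1] vanishes. *)
have [d0 | d_gt0] := posnP d.
  have -> : #|[pred B : subsp K n | facet H B && (z <= B)%VS]| = 1%N.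
    transitivity #|pred1 z|; last by rewrite card1.
    apply: eq_card => B; rewrite !inE.
    apply/idP/eqP => [/andP[/andP[BH dB] zB]|->].
      by apply/eqP; rewrite eq_sym eqEdim zB; move: dE dB; lia.
    by rewrite /facet zH subvv; have := dimvS zH; move: dE; lia.
  by rewrite d0 expn1; lia.
set P := [pred B | _ ]; set N := #|P|.
have dH := dimvS zH.
have cardD (x y : {vspace 'rV[K]_n}) : (x <= y)%VS ->
    #|[pred v | v \in y & v \notin x]| = (q ^ \dim y - q ^ \dim x)%N.
  move=> xy; rewrite -!card_subsp -(cardID [pred v | v \in x] [pred v | v \in y]).
  rewrite [X in (X - _)%N](_ : _ =
    #|[pred v | v \in x]| + #|[pred v in y | v \notin x]|)%N ?addKn //.
  congr (_ + _)%N; apply: eq_card => v; rewrite !inE; last by rewrite andbC.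
  by apply/andb_idl/subvP.
(* Count the pairs of a hyperplane B >= z and a vector v in B outside z. *)
have E1 : (\sum_(B in P) \sum_(v in 'rV[K]_n | (v \in B) && (v \notin z)) 1 =
    N * (q ^ (\dim H).-1 - q ^ \dim z))%N.
  transitivity (\sum_(B in P) (q ^ (\dim H).-1 - q ^ \dim z))%N; last first.
    by rewrite sum_nat_const.
  apply: eq_bigr => B /andP[/andP[BH /eqP dB] zB].
  by rewrite sum1_card cardD // -dB.
have : (\sum_(B in P) \sum_(v in 'rV[K]_n | (v \in B) && (v \notin z)) (q - 1) =
    (q ^ \dim H - q ^ \dim z) * (q ^ d - 1))%N.
  rewrite (exchange_big_dep (fun v => (v \in H) && (v \notin z))) /=; last first.
    by move=> B v /andP[/andP[/subvP BH _] _] /andP[/BH ->].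
  transitivity (\sum_(v in [pred v | v \in H & v \notin z]) (q ^ d - 1))%N; last first.
    by rewrite sum_nat_const cardD.
  apply: eq_bigr => v /andP[vH vz].
  have := IHd (z + <[v]>)%VS; rewrite dimv_addline // subv_add zH -memvE vH => <- //; last by lia.
  rewrite addnK mulnC sum_nat_const; congr (_ * _)%N; apply: eq_card => B.
  by rewrite [LHS]unfold_in /= !inE subv_add -memvE vz andbT andbA.
have -> : (\sum_(B in P) \sum_(v in 'rV[K]_n | (v \in B) && (v \notin z)) (q - 1) =
    N * (q ^ (\dim H).-1 - q ^ \dim z) * (q - 1))%N.
  rewrite -E1 big_distrl; apply: eq_bigr => B _; rewrite big_distrl /=.
  by apply: eq_bigr => v _; rewrite mul1n.
have -> : (\dim H = \dim z + d.+1)%N by lia.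
have fac e : (q ^ (\dim z + e) - q ^ \dim z = q ^ \dim z * (q ^ e - 1))%N.
  by rewrite expnD mulnBr muln1.
rewrite fac addnS /= fac.
move=> E; have : (N * (q - 1) = q ^ d.+1 - 1)%N.
  have qz : (0 < q ^ \dim z * (q ^ d - 1))%N.
    by rewrite muln_gt0 expn_gt0 (ltnW q1) subn_gt0 (leq_ltn_trans d_gt0 (ltn_expl d q1)).
  apply/eqP; rewrite -(eqn_pmul2l qz); apply/eqP.
  by move: (q ^ \dim z)%N (q ^ d - 1)%N (q - 1)%N (q ^ d.+1 - 1)%N E => a b c e; lia.
by rewrite mulnC => ->; rewrite subnK // expn_gt0 (ltnW q1).
Qed.
End Counting.

Lemma span_ind (F : fieldType) (V : vectType F) (X : seq V) (P : V -> Prop) :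
    P 0 -> (forall a f g, P f -> P g -> P (a *: f + g)) -> {in X, forall f, P f} ->
  {in <<X>>%VS, forall f, P f}.
Proof.
move=> P0 PS PX f fX; rewrite (coord_span (fX : f \in <<in_tuple X>>%VS)).
apply: (big_ind P) => // [g h Pg Ph|i _].
  by rewrite -[g]scale1r; apply: PS.
by rewrite -[_ *: _]addr0; apply: PS => //; apply: PX; rewrite mem_nth.
Qed.

(** * Diagram chase for the mapping cone *)

Section Chase.
Variables (F : fieldType) (V : vectType F) (P : nat -> 'End(V)) (G : int -> {vspace V}).
Hypotheses (P0 : forall f, P 0 f = f) (PD : forall i j f, P (i + j) f = P i (P j f)).
Hypothesis PG : forall k j f, f \in G k -> P j f \in G (k - j%:Z).
Variables (m : nat) (N : int).

(* Exactness at (k, i) unless (k, i) is a middle index for N. *)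
Definition exact_outside := forall (k : int) (i : nat) f, (0 < i < m)%N ->
  (k *+ 2 + m%:Z - i%:Z <= N) || (N + m%:Z <= k *+ 2 + m%:Z - i%:Z) ->
  f \in G k -> P i f = 0 -> exists2 g, g \in G (k + m%:Z - i%:Z) & P (m - i) g = f.

Hypothesis GE : exact_outside.

Lemma eq_degree k k' f : k = k' -> f \in G k -> f \in G k'.
Proof. by move=> ->. Qed.

(** The index (b, m - i) is just inside the lower edge of the middle range of [N], so [GE] does not
    apply to it. It applies to (b, m - i + 1) and then to (b - 1, m - i - 1), both on the edge. In
    homology this is surjectivity of the connecting map, induced by [P i.-1]. *)
Lemma split_symmetric_kernel b i f : (0 < i < m)%N -> b *+ 2 = N - i%:Z + 1 ->
    f \in G b -> P (m - i) f = 0 ->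
  exists d g, [/\ d \in G (b + i%:Z - 1), g \in G (b + i%:Z), P i d = 0 &
    f = P i.-1 d + P i g].
Proof.
move=> im bE fG Pf.
have [y yG fE] : exists2 y, y \in G (b + i%:Z - 1) & P i.-1 y = f.
  (* For [i = 1] the exponent m - i + 1 equals [m], out of the range of [GE], and [f] is its own
     preimage. *)
  have [i1 | i1] := eqVneq i 1%N.
    by exists f; rewrite i1 ?P0 // addrK.
  have [||||g gG gE] := GE (k := b) (i := (m - i).+1) (f := f); first by lia.
  - by apply/orP; left; lia.
  - by [].
  - by rewrite -add1n PD Pf linear0.
  exists g; first by apply: eq_degree gG; lia.
  by rewrite -gE; congr (P _ g); lia.
have Py : P (m - i.+1) (P i y) = 0.
  rewrite -PD; have -> : (m - i.+1 + i = (m - i) + i.-1)%N by lia.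
  by rewrite PD fE.
have [g gG gE] : exists2 g, g \in G (b + i%:Z) & P i.+1 g = P i y.
  have [mi | mi] := eqVneq (m - i.+1)%N 0%N.
    by exists 0; rewrite ?mem0v // linear0 -Py mi P0.
  have [||||g gG gE] := GE (k := b - 1) (i := (m - i.+1)%N) (f := P i y); first by lia.
  - by apply/orP; left; lia.
  - by apply: eq_degree (PG i yG); lia.
  - by [].
  exists g; first by apply: eq_degree gG; lia.
  by rewrite -gE; congr (P _ g); lia.
exists (y - P 1 g), g; split=> //.
- by rewrite rpredB //; apply: eq_degree (PG 1 gG); lia.
- by rewrite linearB /= -PD addn1 gE subrr.
rewrite linearB /= -PD; have -> : (i.-1 + 1 = i)%N by lia.
by rewrite fE subrK.
Qed.

(** Injectivity of the connecting map. The index (a, i) is just inside the upper edge of the middle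
    range of [N]. [GE] applies to (a, i - 1) and to (a + 1, i + 1), both on the edge: it lifts
    [f - P 1 y], and then a preimage [y'] of [f] under [P 1]. *)
Lemma lift_symmetric_kernel a i f y : (0 < i < m)%N -> a *+ 2 = N + i%:Z - 1 ->
    f \in G a -> y \in G (a + 1) -> P i f = 0 -> P i.-1 f = P i y ->
  exists2 g, g \in G (a + m%:Z - i%:Z) & P (m - i) g = f.
Proof.
move=> im aE fG yG Pf Pfy.
have Py1 : P 1 y \in G a by apply: eq_degree (PG 1 yG); lia.
have [y' y'G fE] : exists2 y', y' \in G (a + 1) & P 1 y' = f.
  have [i1 | i1] := eqVneq i 1%N.
    by exists y => //; rewrite i1 P0 in Pfy.
  have [||||g gG gE] := GE (k := a) (i := i.-1) (f := f - P 1 y); first by lia.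
  - by apply/orP; right; lia.
  - by rewrite rpredB.
  - rewrite linearB /= -PD; have -> : (i.-1 + 1 = i)%N by lia.
    by rewrite Pfy subrr.
  exists (y + P (m - i) g).
    by rewrite rpredD //; apply: eq_degree (PG (m - i) gG); lia.
  rewrite linearD /= -PD; have -> : (1 + (m - i) = m - i.-1)%N by lia.
  by rewrite gE addrC subrK.
have [mi | mi] := eqVneq i.+1 m.
  exists y'; first by apply: eq_degree y'G; lia.
  by rewrite -fE; congr (P _ y'); lia.
have [||||g gG gE] := GE (k := a + 1) (i := i.+1) (f := y'); first by lia.
- by apply/orP; right; lia.
- by [].
- by rewrite -addn1 PD fE.
exists g; first by apply: eq_degree gG; lia.
by rewrite -fE -gE -PD; congr (P _ g); lia.
Qed.

Variables (c : nat -> F).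

(* Outside the middle range of N + 1, exactness at (k, i) of the cone with
   i-th power of the differential (a, b) |-> (P i a + c i P (i - 1) b, q^i P i b);
   r stands for q^(m - i). *)
Lemma exact_cone k i r a b : (0 < i < m)%N -> c i != 0 -> c (m - i)%N != 0 -> r != 0 ->
    r * c i + c (m - i)%N = 0 ->
    (k *+ 2 + m%:Z - i%:Z <= N + 1) || (N + 1 + m%:Z <= k *+ 2 + m%:Z - i%:Z) ->
    a \in G k -> b \in G (k - 1) -> P i a + c i *: P i.-1 b = 0 -> P i b = 0 ->
  exists a' b', [/\ a' \in G (k + m%:Z - i%:Z), b' \in G (k - 1 + m%:Z - i%:Z),
    P (m - i) a' + c (m - i)%N *: P (m - i).-1 b' = a & r *: P (m - i) b' = b].
Proof.
move=> im ci cmi r0 cE kN aG bG Pab Pb.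
have [d dG dE] : exists2 d, d \in G (k - 1 + m%:Z - i%:Z) & P (m - i) d = b.
  (* [GE] covers the index (k - 1, i) of [b] except in this one case, the upper edge of the middle
     range of N + 1. *)
  have [kE | kNE] := eqVneq (k *+ 2) (N + i%:Z + 1); last first.
    apply: GE => //; case/orP: kN => kN; apply/orP; [left|right]; lia.
  apply: (@lift_symmetric_kernel _ _ _ (- (c i)^-1 *: a)) => //; first by lia.
    by rewrite rpredZ // subrK.
  move/eqP: Pab; rewrite addrC addr_eq0 => /eqP Pab; apply: (scalerI ci).
  by rewrite Pab linearZ /= scalerA mulrN mulfV // scaleN1r.
(* [a1] is [a] minus the contribution of [r^-1 *: d], which lifts [b]. The relation between [c i],
   [c (m - i)] and [r] makes [P i] kill it. *)
pose a1 := a - (c (m - i)%N / r) *: P (m - i).-1 d.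
have a1G : a1 \in G k.
  by rewrite rpredB ?rpredZ //; apply: eq_degree (PG _ dG); lia.
have Pa1 : P i a1 = 0.
  have Pd : P i (P (m - i).-1 d) = P i.-1 b.
    by rewrite -dE -!PD; congr (P _ d); lia.
  rewrite linearB linearZ /= Pd; move/eqP: Pab; rewrite addr_eq0 => /eqP ->.
  rewrite -scaleNr -scalerBl (_ : _ - _ = 0) ?scale0r //.
  apply: (mulfI r0); rewrite mulr0 mulrBr mulrN [r * (_ / _)]mulrC divfK //.
  by rewrite -opprD cE oppr0.
have [kE | kNE] := eqVneq (k *+ 2 + m%:Z - i%:Z) (N + 1).
  have [||||d1 [g [d1G gG Pd1 a1E]]] := @split_symmetric_kernel k (m - i) a1; first by lia.
  - by lia.
  - by [].
  - by rewrite subKn //; lia.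
  (* The term in [d1] does not affect the second coordinate, since [P (m - i)] kills it; in the
     first it supplies the part of [a1] that [P (m - i) g] misses. *)
  exists g, (r^-1 *: d + (c (m - i)%N)^-1 *: d1); split.
  - by apply: eq_degree gG; lia.
  - by rewrite rpredD ?rpredZ //; apply: eq_degree d1G; lia.
  - rewrite linearD !linearZ /= scalerDr !scalerA mulfV // scale1r.
    by rewrite addrCA [P _ g + _]addrC -a1E addrC subrK.
  by rewrite linearD !linearZ /= Pd1 scaler0 addr0 scalerA mulfV // scale1r.
have [||||g gG gE] := GE (k := k) (i := i) (f := a1); try by [].
  by case/orP: kN => kN; apply/orP; [left|right]; lia.
exists g, (r^-1 *: d); split=> //; first by rewrite rpredZ.
  by rewrite linearZ /= scalerA gE subrK.
by rewrite linearZ /= scalerA mulfV // scale1r.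
Qed.

End Chase.

(** * Operators on the span of all subspaces *)

Section Operators.
Variables (F : fieldType) (K : finFieldType) (n : nat).
Hypothesis q_neq0 : #|K|%:R != 0 :> F.
Implicit Types (x y z w B C H : subsp K n) (u v h : 'rV[K]_n) (f g : FL F K n).
Local Notation q := (#|K|%:R : F).
Local Notation D := (incidence F K n).
Local Notation "''b_' x" := (basis_elt F (x%VS : subsp K n))
  (at level 8, x at level 2, format "''b_' x").

Lemma FL_expand f : f = \sum_x f x *: 'b_x.
Proof.
apply/ffunP => z; rewrite sum_ffunE (bigD1 z) //= big1 ?addr0 => [|x xz].
  by rewrite !ffunE eqxx; symmetry; apply: mulr1.
by rewrite !ffunE eq_sym (negPf xz); apply: mulr0.
Qed.

Section LinearExtension.
Variable g : subsp K n -> FL F K n.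
Definition lext_fun f : FL F K n := \sum_x f x *: g x.
Fact lext_fun_is_linear : linear lext_fun.
Proof.
move=> a f f'; rewrite /lext_fun scaler_sumr -big_split /=.
by apply: eq_bigr => x _; rewrite !ffunE scalerDl scalerA.
Qed.
HB.instance Definition _ := GRing.isLinear.Build F (FL F K n) (FL F K n) _
  lext_fun lext_fun_is_linear.
Definition lext : 'End(FL F K n) := linfun lext_fun.
Lemma lextE x : lext 'b_x = g x.
Proof.
rewrite lfunE /= /lext_fun (bigD1 x) //= big1 ?addr0 => [|y yx]; rewrite !ffunE.
  by rewrite eqxx scale1r.
by rewrite (negPf yx) scale0r.
Qed.
End LinearExtension.

Lemma incidence_basis x : D 'b_x = \sum_(y | facet x y) 'b_y.
Proof.
by have := lextE (fun x => \sum_(y | facet x y) 'b_y) x; rewrite !lfunE.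
Qed.

(** Relative version of [M], which allows induction on [W]; [M] is recovered at [W = fullv]. *)
Definition graded (W : subsp K n) (k : int) : {vspace FL F K n} :=
  <<[seq 'b_x | x in [pred x : subsp K n | (x <= W)%VS && ((\dim x)%:Z == k)]]>>%VS.

Lemma graded_basis W x : (x <= W)%VS -> 'b_x \in graded W (\dim x)%:Z.
Proof. by move=> xW; apply/memv_span/image_f; rewrite inE xW eqxx. Qed.

Lemma graded_ind W k (P : FL F K n -> Prop) :
    P 0 -> (forall a f g, P f -> P g -> P (a *: f + g)) ->
    (forall x, (x <= W)%VS -> (\dim x)%:Z = k -> P 'b_x) ->
  {in graded W k, forall f, P f}.
Proof.
move=> P0 PS Px; apply: span_ind => // _ /imageP[x /andP[xW /eqP xk] ->].
exact: Px.
Qed.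

Lemma graded_eq W k (f g : 'End(FL F K n)) :
  (forall x, (x <= W)%VS -> f 'b_x = g 'b_x) -> {in graded W k, f =1 g}.
Proof.
move=> fg; apply: graded_ind => [|a f1 f2 E1 E2|x /fg //].
  by rewrite !linear0.
by rewrite !linearP; congr (_ *: _ + _).
Qed.

Lemma graded_mem W k (f : 'End(FL F K n)) (V : {vspace FL F K n}) :
  (forall x, (x <= W)%VS -> (\dim x)%:Z = k -> f 'b_x \in V) ->
  {in graded W k, forall g, f g \in V}.
Proof.
move=> fV; apply: graded_ind => [|a f1 f2 E1 E2|//]; first by rewrite linear0 mem0v.
by rewrite linearP rpredD ?rpredZ.
Qed.

Lemma graded_sub W W' k : (W <= W')%VS -> (graded W k <= graded W' k)%VS.
Proof.
move=> WW'; apply/subvP; apply: graded_ind => [|a f g|x xW <-]; first exact: mem0v.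
  by move=> fW gW; rewrite rpredD ?rpredZ.
by rewrite graded_basis ?(subv_trans xW).
Qed.

Lemma graded_out W k f : ~ (0 <= k <= (\dim W)%:Z) -> f \in graded W k -> f = 0.
Proof.
move=> kW; move: f; apply: graded_ind => // [a f g -> ->|x xW xk].
  by rewrite scaler0 addr0.
by case: kW; rewrite -xk !lez_nat dimvS.
Qed.

Lemma graded_incidence W k f : f \in graded W k -> D f \in graded W (k - 1).
Proof.
move: f; apply: graded_mem => x xW <-; rewrite incidence_basis rpred_sum // => y.
case/andP=> yx /eqP <-; rewrite -natz -addn1 natrD addrK natz.
by rewrite graded_basis ?(subv_trans yx).
Qed.

Local Notation Dp := (incidence_pow F K n).

Lemma incidence_powS j f : Dp j.+1 f = D (Dp j f).
Proof. by rewrite /incidence_pow /= lfunE. Qed.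

Lemma incidence_powD i j f : Dp (i + j) f = Dp i (Dp j f).
Proof.
elim: i => [|i IHi]; first by rewrite add0n {2}/incidence_pow /= lfunE.
by rewrite addSn !incidence_powS IHi.
Qed.

Lemma graded_incidence_pow W k j f : f \in graded W k -> Dp j f \in graded W (k - j%:Z).
Proof.
elim: j => [|j IHj] fW; first by rewrite /incidence_pow /= lfunE /= subr0.
rewrite incidence_powS -[j.+1]addn1 -natz natrD natz opprD addrA.
by apply: graded_incidence; apply: IHj.
Qed.

(* The operators below are sealed behind a Qed: otherwise the unifier unfolds
   them and compares matrices. *)
Fact affavg_exists : {A : subsp K n -> 'rV[K]_n -> 'End(FL F K n) | forall C u y,
  A C u 'b_y = (q ^+ \dim C)^-1 *: \sum_(c : 'rV[K]_n | c \in C) 'b_(y + <[u + c]>)}.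
Proof.
exists (fun C u => lext (fun y => (q ^+ \dim C)^-1 *:
  \sum_(c : 'rV[K]_n | c \in C) 'b_(y + <[u + c]>))).
by move=> C u y; rewrite lextE.
Qed.
(** For [y] in [C] and [u] outside [C], the average of [y + <[u]>] over the transvections of [C +
    <[u]>] with axis [C], which move [u] by the vectors of [C]. *)
Definition affavg := sval affavg_exists.
Lemma affavgE C u y : affavg C u 'b_y =
  (q ^+ \dim C)^-1 *: \sum_(c : 'rV[K]_n | c \in C) 'b_(y + <[u + c]>).
Proof. exact: (svalP affavg_exists). Qed.

Lemma card_subspF (V : {vspace 'rV[K]_n}) :
  \sum_(c : 'rV[K]_n | c \in V) 1 = q ^+ \dim V.
Proof.
by rewrite sumr_const -natrX -card_subsp; congr (_%:R); apply: eq_card => v; rewrite inE.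
Qed.

Lemma sum_shift (T : nmodType) C v (G : 'rV[K]_n -> T) : v \in C ->
  \sum_(c : 'rV[K]_n | c \in C) G (v + c) = \sum_(c : 'rV[K]_n | c \in C) G c.
Proof.
move=> vC; rewrite [RHS](reindex_inj (addrI v)); apply: eq_bigl => c.
by rewrite rpredDl.
Qed.

Lemma end_eq (f g : 'End(FL F K n)) : (forall x, f 'b_x = g 'b_x) -> f = g.
Proof.
move=> fg; apply/lfunP => h; rewrite [h]FL_expand !linear_sum.
by apply: eq_bigr => x _; rewrite !linearZ /= fg.
Qed.

(** Translation by a vector of [y] permutes [C], so the sum over [C] absorbs the inner average over
    [y]. *)
Lemma sum_affavg C y u : (y <= C)%VS ->
  \sum_(c : 'rV[K]_n | c \in C) affavg y (u + c) = q ^+ \dim C *: affavg C u.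
Proof.
move=> yC; apply: end_eq => x; rewrite sum_lfunE scale_lfunE [in RHS]affavgE scalerA.
rewrite divff ?expf_neq0 // scale1r.
under eq_bigr => c _ do rewrite affavgE.
rewrite -scaler_sumr exchange_big /=.
under eq_bigr => v vy.
  under eq_bigr => c _ do rewrite -addrA [c + v]addrC.
  rewrite (sum_shift (fun c => 'b_(x + <[u + c]>)) (subvP yC v vy)) -[\sum_(c : _ | _) _]scale1r.
  over.
by rewrite -scaler_suml card_subspF scalerA mulVf ?expf_neq0 // scale1r.
Qed.


Lemma addline_eq y w H u h h' : (y <= H)%VS -> (w <= H)%VS -> u \notin H ->
  h \in H -> h' \in H ->
  ((w + <[u + h]>)%VS == (y + <[u + h']>)%VS :> subsp K n) = (w == y) && (h - h' \in y).
Proof.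
move=> yH wH uH hH h'H; have -> : u + h = u + h' + (h - h') by rewrite addrACA subrr addr0.
have uh'H : u + h' \notin H by rewrite notin_shift.
have hh'H : h - h' \in H by rewrite rpredB.
apply/eqP/andP => [E | [/eqP-> hy]]; last by rewrite (addline_shift yH).
have /andP[wy hy] : (w <= y)%VS && (h - h' \in y).
  by rewrite -(addlineS yH wH uh'H hh'H) E.
split=> //; rewrite eqEdim wy /=.
by rewrite -ltnS -(dimv_addline_notin yH uh'H) -E (dimv_addline_notin wH) // notin_shift.
Qed.

Lemma sum_coset (T : nmodType) C v (G : 'rV[K]_n -> T) :
  \sum_(c : 'rV[K]_n | c - v \in C) G c = \sum_(c : 'rV[K]_n | c \in C) G (v + c).
Proof.
by rewrite (reindex_inj (addrI v)); apply: eq_bigl => c; rewrite addrAC subrr add0r.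
Qed.

(** The facets of [y + <[u]>] are [y] and the spaces [w + <[u + v]>], with [w] a facet of [y] and
    [v] in [y]. Each of the latter arises from the vectors [v] of one coset of [w], and their number
    is the divisor in [affavg y] divided by [q]; hence the factor [q]. *)
Lemma incidence_addline y u : u \notin y ->
  D 'b_(y + <[u]>) = 'b_y + q *: affavg y u (D 'b_y).
Proof.
move=> uy; rewrite !incidence_basis (bigD1 y) /=; last first.
  by rewrite /facet addvSl /= dimv_addline.
congr (_ + _).
(* A zero [y] has no facets; the predecessor in the exponent below needs a positive dimension. *)
have [d0 | d_gt0] := posnP (\dim y).
  rewrite big_pred0 => [|z]; last first.
    apply/negP => /andP[/andP[zyu]]; rewrite dimv_addline // d0 eqSS dimv_eq0.
    by move/eqP->; rewrite eq_sym -dimv_eq0 d0 eqxx.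
  rewrite big_pred0 => [|z]; first by rewrite linear0 scaler0.
  by rewrite /facet d0 andbF.
rewrite linear_sum scaler_sumr /=.
have -> : \sum_(w | facet y w) q *: affavg y u 'b_w = (q ^+ (\dim y).-1)^-1 *: \sum_(w | facet y w)
    \sum_(z | facet (y + <[u]>)%VS z && (z != y)) 
     \sum_(v : 'rV[K]_n | v \in y) ((w + <[u + v]>)%VS == z)%:R *: 'b_z.
  rewrite scaler_sumr; apply: eq_bigr => w /andP[wy /eqP dw].
  rewrite affavgE scalerA -[in q ^+ _](prednK d_gt0) exprS invfM mulrA divff // mul1r.
  congr (_ *: _); rewrite exchange_big; apply: eq_bigr => v vy /=.
  rewrite (bigD1 ((w + <[u + v]>)%VS : subsp K n)) /=.
    rewrite eqxx scale1r big1 ?addr0 // => z /andP[_ /negPf].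
    by rewrite eq_sym => ->; rewrite scale0r.
  rewrite /facet (addlineS (subvv _) wy uy vy) wy vy /= (dimv_addline uy).
  rewrite (dimv_addline_notin wy) ?notin_shift // dw eqxx /=.
  apply: contraTneq (addvSr w <[u + v]>) => ->; rewrite -memvE.
  by rewrite notin_shift.
rewrite exchange_big scaler_sumr; apply: eq_bigr => z /andP[/andP[zyu dz] zy] /=.
have dzE : \dim z = \dim y by move: dz; rewrite dimv_addline // eqSS => /eqP.
have zNy : ~~ (z <= y)%VS by apply: contra zy => ?; rewrite eqEdim dzE leqnn andbT.
have [v0 v0y zE] := addline_split zyu zNy.
(* The coefficient at [z] comes only from [w = w0], with [v] in the coset [v0 + w0]. *)
set w0 : subsp K n := (z :&: y)%VS in zE; have w0y : (w0 <= y)%VS := capvSr _ _.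
have uv0y : u + v0 \notin y by rewrite notin_shift.
have dw0 : \dim y = (\dim w0).+1 by rewrite -dzE zE (dimv_addline_notin w0y).
rewrite (bigD1 w0) /=; last by rewrite /facet w0y dw0 eqxx.
rewrite [X in _ + X]big1 ?addr0 => [|w /andP[/andP[wy _] ww0]]; last first.
  by apply: big1 => v vy; rewrite zE (addline_eq w0y wy) // (negPf ww0) scale0r.
rewrite -scaler_suml (bigID (fun v => v - v0 \in w0)) /= addrC big1 ?add0r; last first.
  by move=> v /andP[vy /negPf vv0]; rewrite zE (addline_eq w0y w0y) // vv0 andbF.
rewrite (eq_bigl (fun v => v - v0 \in w0)) => [|v]; last first.
  by apply: andb_idl => /(subvP w0y) vv0; rewrite -(subrK v0 v) rpredD.
rewrite (eq_bigr (fun=> 1)) => [|v vv0]; last first.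
  by rewrite zE (addline_eq w0y w0y) ?vv0 ?eqxx // -(subrK v0 v) rpredD // (subvP w0y).
by rewrite sum_coset card_subspF dw0 scalerA mulVf ?expf_neq0 // scale1r.
Qed.

(** Average [incidence_addline] over the shifts of [u] by [C]; [sum_affavg] merges the averages over
    [y] into one over [C]. This is the q-Weyl relation D A = 1 + q A D. *)
Lemma incidence_affavg C H u k : (C <= H)%VS -> u \notin H ->
  {in graded C k, forall f, D (affavg C u f) = f + q *: affavg C u (D f)}.
Proof.
move=> CH uH; apply: graded_ind => [|a f g fE gE|y yC _].
- by rewrite !(linear0, scaler0, addr0).
- by rewrite !linearP /= fE gE scalerDr addrACA.
rewrite affavgE linearZ linear_sum /=.
rewrite (eq_bigr (fun c => 1 *: 'b_y + q *: affavg y (u + c) (D 'b_y))) => [|c cC]; last first.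
  rewrite scale1r incidence_addline //; apply: contra uH => /(subvP (subv_trans yC CH)).
  by rewrite rpredDr // (subvP CH).
rewrite big_split /= -scaler_suml -scaler_sumr -sum_lfunE sum_affavg // scale_lfunE.
rewrite card_subspF scalerDr !scalerA mulVf ?expf_neq0 // scale1r; congr (_ + _ *: _).
by rewrite mulrAC mulVf ?mul1r ?expf_neq0.
Qed.

Lemma qintS j : qint F #|K| j.+1 = qint F #|K| j + q ^+ j.
Proof. by rewrite /qint big_ord_recr. Qed.

Lemma qint0 : qint F #|K| 0 = 0.
Proof. by rewrite /qint big_ord0. Qed.

Lemma incidence_pow0 f : Dp 0 f = f.
Proof. by rewrite /incidence_pow /= lfunE. Qed.

(** Iterating D A = 1 + q A D accumulates 1 + q + ... into $[j]_q$. At [j = 0] the truncated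
    predecessor is harmless, as $[0]_q=0$. *)
Lemma incidence_pow_affavg C H u k j : (C <= H)%VS -> u \notin H ->
  {in graded C k, forall f, Dp j (affavg C u f) =
    qint F #|K| j *: Dp j.-1 f + q ^+ j *: affavg C u (Dp j f)}.
Proof.
move=> CH uH f fC; elim: j => [|j IHj].
  by rewrite qint0 scale0r add0r expr0 scale1r !incidence_pow0.
rewrite incidence_powS IHj linearP linearZ /=.
rewrite (incidence_affavg CH uH (graded_incidence_pow j fC)) -incidence_powS.
rewrite qintS exprS scalerDl scalerDr scalerA addrA [q * _]mulrC; congr (_ + _ + _);
  last by rewrite incidence_powS.
by case: j {IHj} => [|j]; rewrite ?qint0 ?scale0r // -incidence_powS.
Qed.

Lemma hyperplane_exists W : (0 < \dim W)%N ->
  exists (H : subsp K n) e, e \notin H /\ W = (H + <[e]>)%VS.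
Proof.
rewrite lt0n dimv_eq0 => W0; set u := vpick W.
exists (W :\: <[u]>)%VS, u; split; last first.
  by rewrite addv_diff; symmetry; apply/addv_idPl; rewrite -memvE memv_pick.
have: u != 0 by rewrite vpick0.
apply: contra => uy; rewrite -memv0 -(capv_diff W <[u]>).
by rewrite memv_cap uy memv_line.
Qed.

(** Induction on the dimension. With [x = y + <[u]>], all shifts of [u] by [y] give [x], so ['b_x]
    is an [affavg]. Its image has a term with factor $[m]_q=0$ and a term that vanishes by induction
    on [y]. *)
Lemma incidence_pow_eq0 m W k : qint F #|K| m = 0 -> (0 < m)%N ->
  {in graded W k, forall f, Dp m f = 0}.
Proof.
move=> qm0 m_gt0; have [d] := ubnP (\dim W); elim: d W k => // d IHd W k Wd.
apply: graded_ind => [|a f g fE gE|x xW _]; first by rewrite linear0.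
  by rewrite linearP /= fE gE scaler0 addr0.
have [x0 | x0] := eqVneq (x : {vspace _}) 0%VS.
  rewrite -(prednK m_gt0) -addn1 incidence_powD incidence_powS incidence_pow0.
  rewrite incidence_basis big_pred0 ?linear0 // => y.
  by rewrite /facet x0 dimv0 andbF.
have [y [u [uy xE]]] : exists (y : subsp K n) u, u \notin y /\ x = (y + <[u]>)%VS.
  by apply: hyperplane_exists; rewrite lt0n dimv_eq0.
have -> : 'b_x = affavg y u 'b_y.
  rewrite affavgE (eq_bigr (fun=> 1 *: 'b_x)).
    by rewrite -scaler_suml card_subspF scalerA mulVf ?expf_neq0 // scale1r.
  by move=> c cy; rewrite (addline_shift (subvv y)) // -xE scale1r.
rewrite (incidence_pow_affavg _ (subvv y) uy (graded_basis (subvv y))).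
rewrite qm0 scale0r add0r (IHd y _ _ _ (graded_basis (subvv y))) ?linear0 ?scaler0 //.
by rewrite ltnS in Wd; rewrite (leq_trans _ Wd) // -(dimv_addline uy) -xE dimvS.
Qed.

(** * Splitting the span over [W] along a hyperplane [H] *)

Section Hyperplane.
Variables (H : subsp K n) (e : 'rV[K]_n).
Hypothesis eH : e \notin H.
Local Notation W := (H + <[e]>)%VS.

Lemma sub_addline_ind (P : subsp K n -> Prop) :
    (forall x, (x <= H)%VS -> P x) ->
    (forall y h, (y <= H)%VS -> h \in H -> P (y + <[e + h]>)%VS) ->
  forall x, (x <= W)%VS -> P x.
Proof.
move=> P1 P2 x xW; have [/P1 // | xH] := boolP (x <= H)%VS.
by have [h hH ->] := addline_split xW xH; apply: P2; rewrite ?capvSr.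
Qed.

Fact restr_exists : {A : 'End(FL F K n) | forall x, A 'b_x = (x <= H)%VS%:R *: 'b_x}.
Proof. by exists (lext (fun x => (x <= H)%VS%:R *: 'b_x)) => x; rewrite lextE. Qed.
Definition restr := sval restr_exists.
Lemma restrE x : restr 'b_x = (x <= H)%VS%:R *: 'b_x.
Proof. exact: (svalP restr_exists). Qed.

Fact proj_exists : {A : subsp K n -> 'rV[K]_n -> 'End(FL F K n) | forall C u x,
  A C u 'b_x = (~~ (x <= H) && (x <= C + <[u]>))%VS%:R *: 'b_(x :&: H)}.
Proof.
exists (fun C u => lext (fun x => (~~ (x <= H) && (x <= C + <[u]>))%VS%:R *: 'b_(x :&: H))).
by move=> C u x; rewrite lextE.
Qed.
(** With [C = H] this is the second cone coordinate, [restr] being the first. With [C] a facet [B]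
    of [H] it sees only the subspaces of the hyperplane [B + <[u]>] of [W]. *)
Definition proj := sval proj_exists.
Lemma projE C u x : proj C u 'b_x = (~~ (x <= H) && (x <= C + <[u]>))%VS%:R *: 'b_(x :&: H).
Proof. exact: (svalP proj_exists). Qed.

Lemma restr_sub x : (x <= H)%VS -> restr 'b_x = 'b_x.
Proof. by move=> xH; rewrite restrE xH scale1r. Qed.

Lemma restr_addline y h : h \in H -> restr 'b_(y + <[e + h]>) = 0.
Proof.
move=> hH; have uH : e + h \notin H by rewrite notin_shift.
by rewrite restrE (negPf (not_sub_addline y uH)) scale0r.
Qed.

Lemma proj_sub C u x : (x <= H)%VS -> proj C u 'b_x = 0.
Proof. by move=> xH; rewrite projE xH scale0r. Qed.

Lemma proj_addline C y h h' : (C <= H)%VS -> (y <= H)%VS -> h \in H -> h' \in H ->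
  proj C (e + h) 'b_(y + <[e + h']>) = ((y <= C)%VS && (h' - h \in C))%:R *: 'b_y.
Proof.
move=> CH yH hH h'H; have uH : e + h \notin H by rewrite notin_shift.
have u'H : e + h' \notin H by rewrite notin_shift.
have hh'H : h' - h \in H by rewrite rpredB.
have sub := addlineS CH yH uH hh'H; rewrite -addrA [h + _]addrC subrK in sub.
by rewrite projE sub (capv_addline yH u'H) (not_sub_addline y u'H).
Qed.

Lemma proj_affavg C C' y h h' : (C <= H)%VS -> (C' <= H)%VS -> (y <= H)%VS ->
    h \in H -> h' \in H ->
  proj C (e + h) (affavg C' (e + h') 'b_y) =
  ((q ^+ \dim C')^-1 * \sum_(c : 'rV[K]_n | c \in C') (h' + c - h \in C)%:R) *:
    ((y <= C)%VS%:R *: 'b_y).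
Proof.
move=> CH C'H yH hH h'H; rewrite affavgE linearZ linear_sum /= -scalerA; congr (_ *: _).
rewrite scaler_suml; apply: eq_bigr => c cC'; rewrite -addrA proj_addline //.
  by rewrite -mulnb natrM mulrC scalerA.
by rewrite rpredD // (subvP C'H).
Qed.

(** A subspace of [W] outside [H] has exactly one facet in [H], its trace, which [proj H e]
    records. *)
Lemma restr_incidence k :
  {in graded W k, forall f, restr (D f) = D (restr f) + proj H e f}.
Proof.
have restrD y : (y <= H)%VS -> restr (D 'b_y) = D 'b_y.
  move=> yH; rewrite incidence_basis linear_sum /=; apply: eq_bigr => z /andP[zy _].
  by rewrite restr_sub // (subv_trans zy).
move=> f fW; rewrite -!comp_lfunE -add_lfunE; move: f fW.
apply: graded_eq; apply: sub_addline_ind => [x xH|y h yH hH].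
  by rewrite add_lfunE !comp_lfunE restrD // restr_sub // proj_sub // addr0.
rewrite add_lfunE !comp_lfunE restr_addline // linear0 add0r.
rewrite -{2}[e]addr0 proj_addline ?subvv ?mem0v // subr0 hH yH /= scale1r.
rewrite incidence_addline; last first.
  by apply: contra eH => /(subvP yH); rewrite rpredDr.
rewrite linearD linearZ /= restr_sub // [X in _ + _ *: X](_ : _ = 0) ?scaler0 ?addr0 //.
rewrite incidence_basis !linear_sum big1 //= => w _.
rewrite affavgE linearZ linear_sum /= big1 ?scaler0 // => v vy.
by rewrite -addrA restr_addline // rpredD // (subvP yH).
Qed.

Lemma proj_incidence_sub C u x : (x <= H)%VS -> proj C u (D 'b_x) = 0.
Proof.
move=> xH; rewrite incidence_basis linear_sum big1 //= => z /andP[zx _].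
by rewrite proj_sub // (subv_trans zx).
Qed.

Lemma proj_incidence_addline C y h h' :
    (C <= H)%VS -> (y <= H)%VS -> h \in H -> h' \in H ->
  proj C (e + h) (D 'b_(y + <[e + h']>)) =
  (q * (q ^+ \dim y)^-1 * \sum_(v : 'rV[K]_n | v \in y) (h' + v - h \in C)%:R) *:
    \sum_(w | facet y w) (w <= C)%VS%:R *: 'b_w.
Proof.
move=> CH yH hH h'H; rewrite incidence_addline; last first.
  by apply: contra eH => /(subvP yH); rewrite rpredDr.
rewrite linearD linearZ /= proj_sub // add0r -mulrA -scalerA; congr (_ *: _).
rewrite incidence_basis !linear_sum; apply: eq_bigr => w /andP[wy _] /=.
by rewrite proj_affavg // (subv_trans wy).
Qed.

(** If [x] has trace [y] on [H], each facet of [y] is the trace of exactly [q] facets of [x]. *)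
Lemma proj_incidence k :
  {in graded W k, forall f, proj H e (D f) = q *: D (proj H e f)}.
Proof.
move=> f fW; rewrite -!comp_lfunE -scale_lfunE; move: f fW.
apply: graded_eq; apply: sub_addline_ind => [x xH|y h yH hH].
  by rewrite scale_lfunE !comp_lfunE proj_incidence_sub // proj_sub // linear0 scaler0.
rewrite scale_lfunE !comp_lfunE -[e in proj H e]addr0 proj_incidence_addline ?mem0v //.
rewrite proj_addline ?mem0v // yH subr0 hH /= scale1r incidence_basis.
rewrite (eq_bigr (fun=> 1)) => [|v vy]; last by rewrite subr0 rpredD // (subvP yH).
rewrite card_subspF -mulrA mulVf ?expf_neq0 // mulr1; congr (_ *: _).
by apply: eq_bigr => w /andP[wy _]; rewrite (subv_trans wy) // scale1r.
Qed.

(* Unlike proj and affavg, the following differences commute with the incidence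
   map up to the factor q. *)
Fact dproj_exists : {A : subsp K n -> 'rV[K]_n -> 'End(FL F K n) | forall B h f,
  A B h f = proj B (e + h) f - proj B e f}.
Proof.
by exists (fun B h => proj B (e + h) - proj B e) => B h f; rewrite add_lfunE opp_lfunE.
Qed.
Definition dproj := sval dproj_exists.
Lemma dprojE B h f : dproj B h f = proj B (e + h) f - proj B e f.
Proof. exact: (svalP dproj_exists). Qed.

Fact daffavg_exists : {A : subsp K n -> 'rV[K]_n -> 'End(FL F K n) | forall B h f,
  A B h f = affavg B (e + h) f - affavg H e f}.
Proof.
by exists (fun B h => affavg B (e + h) - affavg H e) => B h f; rewrite add_lfunE opp_lfunE.
Qed.
Definition daffavg := sval daffavg_exists.
Lemma daffavgE B h f : daffavg B h f = affavg B (e + h) f - affavg H e f.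
Proof. exact: (svalP daffavg_exists). Qed.

Lemma facet_sub_eq B y : facet H B -> (y <= H)%VS -> ~~ (y <= B)%VS -> (y + B)%VS = H.
Proof.
case/andP=> BH /eqP dB yH yB; apply/eqP; rewrite eqEdim subv_add yH BH -dB /=.
rewrite ltn_neqAle dimvS ?addvSr // andbT.
apply: contra yB => /eqP dE; apply: (subv_trans (addvSl y B)).
by rewrite -(dimv_leqif_sup (addvSr y B)) dE.
Qed.

(** For [y] in [B] each of the two projections commutes with [D] up to [q]. Otherwise [y + B = H],
    so the number of [v] in [y] with [s + v] in [B] is the same for all [s] in [H], and the two
    projections of the image cancel. *)
Lemma dproj_incidence B h k : facet H B -> h \in H ->
  {in graded W k, forall f, dproj B h (D f) = q *: D (dproj B h f)}.
Proof.
move=> HB hH; have /andP[BH _] := HB.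
move=> f fW; rewrite -!comp_lfunE -scale_lfunE; move: f fW.
apply: graded_eq; apply: sub_addline_ind => [x xH|y h' yH h'H].
  rewrite scale_lfunE !comp_lfunE !dprojE !proj_incidence_sub // !proj_sub //.
  by rewrite subrr linear0 scaler0.
rewrite scale_lfunE !comp_lfunE !dprojE.
have := proj_incidence_addline BH yH (mem0v H) h'H; rewrite addr0 => ->.
have := proj_addline BH yH (mem0v H) h'H; rewrite addr0 => ->.
rewrite (proj_incidence_addline BH yH hH h'H) (proj_addline BH yH hH h'H).
have [yB | yB] := boolP (y <= B)%VS; last first.
  rewrite /= !scale0r subrr !linear0; apply/eqP; rewrite subr_eq0; apply/eqP.
  suff count s : s \in H -> \sum_(v : 'rV[K]_n | v \in y) ((s + v \in B)%:R : F) =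
      \sum_(v : 'rV[K]_n | v \in y) (v \in B)%:R.
    under eq_bigr => v _ do rewrite addrAC.
    rewrite count ?rpredB //; congr ((_ * _) *: _).
    by under eq_bigr => v _ do rewrite addrAC; rewrite count // rpredD // mem0v.
  rewrite -(facet_sub_eq HB yH yB) => /memv_addP[v0 v0y [b bB ->]].
  rewrite -[RHS](sum_shift _ v0y); apply: eq_bigr => v _.
  by rewrite -addrA addrCA rpredDl.
have count s : \sum_(v : 'rV[K]_n | v \in y) ((h' + v - s \in B)%:R : F) =
    q ^+ \dim y * (h' - s \in B)%:R.
  rewrite -card_subspF mulr_suml; apply: eq_bigr => v vy.
  by rewrite mul1r addrAC rpredDr // (subvP yB).
rewrite /= !count -!mulrA !mulKf ?expf_neq0 // -scalerBl -mulrBr -scalerBl linearZ /= scalerA.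
congr (_ *: _); rewrite incidence_basis; apply: eq_bigr => w /andP[wy _].
by rewrite (subv_trans wy) // scale1r.
Qed.

Lemma affavg_shift C h u f : h \in C -> affavg C (u + h) f = affavg C u f.
Proof.
move=> hC; have -> // : affavg C (u + h) = affavg C u.
apply: end_eq => x; apply: etrans (affavgE _ _ _) _; apply: etrans (esym (affavgE _ _ _)).
congr (_ *: _); rewrite -(sum_shift (fun c => 'b_(x + <[u + c]>)) hC).
by under eq_bigr => c _ do rewrite -addrA.
Qed.

(** The $[j]_q$ term of [incidence_pow_affavg] is the same for both averages and cancels in the
    difference. *)
Lemma daffavg_incidence_pow B h k j : (B <= H)%VS -> h \in H ->
  {in graded B k, forall f, Dp j (daffavg B h f) = q ^+ j *: daffavg B h (Dp j f)}.
Proof.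
move=> BH hH f fB; have uH : e + h \notin H by rewrite notin_shift.
have fH : f \in graded H k := subvP (graded_sub k BH) f fB.
rewrite daffavgE linearB /= (incidence_pow_affavg _ BH uH fB).
rewrite (incidence_pow_affavg _ (subvv H) eH fH).
by rewrite opprD addrACA subrr add0r -scalerBr daffavgE.
Qed.

Lemma dproj_incidence_pow B h k j : facet H B -> h \in H ->
  {in graded W k, forall f, dproj B h (Dp j f) = q ^+ j *: Dp j (dproj B h f)}.
Proof.
move=> HB hH f fW; elim: j => [|j IHj]; first by rewrite !incidence_pow0 expr0 scale1r.
rewrite !incidence_powS (dproj_incidence HB hH (graded_incidence_pow j fW)) IHj.
by rewrite linearZ /= scalerA exprS.
Qed.

(** Powers of the cone differential $(a,b)\mapsto(Da+b,\,qDb)$: the off-diagonal weights 1, q, ...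
    add up to $[j]_q$. *)
Lemma restr_proj_incidence_pow k j : {in graded W k, forall f,
  restr (Dp j f) = Dp j (restr f) + qint F #|K| j *: Dp j.-1 (proj H e f) /\
  proj H e (Dp j f) = q ^+ j *: Dp j (proj H e f)}.
Proof.
move=> f fW; elim: j => [|j [IH1 IH2]].
  by rewrite !incidence_pow0 qint0 scale0r addr0 expr0 scale1r.
rewrite !incidence_powS (restr_incidence (graded_incidence_pow j fW)).
rewrite (proj_incidence (graded_incidence_pow j fW)) IH1 IH2 linearD !linearZ /=; split.
  rewrite -addrA qintS scalerDl; congr (_ + (_ + _)).
  by case: j {IH1 IH2} => [|j]; rewrite ?qint0 ?scale0r // -incidence_powS.
by rewrite scalerA exprSr.
Qed.

Lemma affavg_graded C u k : (C <= W)%VS -> u \notin C -> u \in W ->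
  {in graded C k, forall f, affavg C u f \in graded W (k + 1)}.
Proof.
move=> CW uC uW; apply: graded_mem => y yC <-; rewrite affavgE rpredZ // rpred_sum // => c cC.
have ucy : u + c \notin y.
  by apply: contra uC => /(subvP yC); rewrite rpredDr.
have -> : (\dim y)%:Z + 1 = (\dim (y + <[u + c]>))%:Z by rewrite dimv_addline // intS addrC.
apply: graded_basis; rewrite subv_add (subv_trans yC CW) -memvE rpredD //.
exact: (subvP CW).
Qed.

Lemma daffavg_graded B h k : (B <= H)%VS -> h \in H ->
  {in graded B k, forall f, daffavg B h f \in graded W (k + 1)}.
Proof.
move=> BH hH f fB; have uH : e + h \notin H by rewrite notin_shift.
have HW : (H <= W)%VS := addvSl _ _.
have eW : e \in W by rewrite (subvP (addvSr _ _)) ?memv_line.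
rewrite daffavgE rpredB //.
  apply: affavg_graded => //; first exact: subv_trans HW.
    by apply: contra uH; apply: subvP.
  by rewrite rpredD // (subvP HW).
by apply: affavg_graded => //; apply: (subvP (graded_sub k BH)).
Qed.

Lemma restr_graded k : {in graded W k, forall f, restr f \in graded H k}.
Proof.
apply: graded_mem => x _ <-; rewrite restrE; case xH: (x <= H)%VS.
  by rewrite scale1r graded_basis.
by rewrite scale0r mem0v.
Qed.

Lemma proj_graded C h k : (C <= H)%VS -> h \in H ->
  {in graded W k, forall f, proj C (e + h) f \in graded C (k - 1)}.
Proof.
move=> CH hH; apply: graded_mem => x xW <-; move: x xW.
apply: sub_addline_ind => [x xH|y h' yH h'H]; first by rewrite proj_sub // mem0v.
rewrite proj_addline // (dimv_addline_notin yH) ?notin_shift // intS addrAC subrr add0r.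
case yC: (y <= C)%VS; last by rewrite scale0r mem0v.
by rewrite rpredZ // graded_basis.
Qed.

Lemma dproj_graded B h k : (B <= H)%VS -> h \in H ->
  {in graded W k, forall f, dproj B h f \in graded B (k - 1)}.
Proof.
move=> BH hH f fW; rewrite dprojE rpredB ?proj_graded //.
by rewrite -[e]addr0 proj_graded ?mem0v.
Qed.

(** This makes the shifted copy of the span over [B] a direct summand. Of the four terms, the
    projection at [e + h] of the average over [B] gives [f], the one at [e] vanishes as [h] is not
    in [B], and the two for the average over [H] agree by translation. *)
Lemma dprojK B h k : facet H B -> h \in H -> h \notin B ->
  {in graded B k, forall f, dproj B h (daffavg B h f) = f}.
Proof.
move=> HB hH hB; have /andP[BH _] := HB.
apply: graded_ind => [|a f g fE gE|y yB _]; first by rewrite !linear0.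
  by rewrite !linearP /= fE gE.
have yH := subv_trans yB BH.
rewrite daffavgE linearB /= !dprojE.
have P := @proj_affavg B _ y _ _ BH _ yH.
rewrite (P _ _ _ BH hH hH).
have := P _ _ _ BH (mem0v H) hH; rewrite addr0 => ->.
have := P _ _ _ (subvv H) hH (mem0v H); rewrite addr0 => ->.
have := P _ _ _ (subvv H) (mem0v H) (mem0v H); rewrite addr0 => ->.
rewrite yB scale1r.
have -> : \sum_(c : 'rV[K]_n | c \in B) ((h + c - h \in B)%:R : F) = q ^+ \dim B.
  by rewrite -card_subspF; apply: eq_bigr => c cB; rewrite addrAC subrr add0r cB.
have -> : \sum_(c : 'rV[K]_n | c \in B) ((h + c - 0 \in B)%:R : F) = 0.
  by apply: big1 => c cB; rewrite subr0 rpredDr // (negPf hB).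
rewrite -(sum_shift (fun c => ((0 + c - h \in B)%:R : F)) hH).
rewrite (eq_bigr (fun c => (0 + c - 0 \in B)%:R)) => [|c _].
  by rewrite subrr subr0 mulr0 scale0r subr0 mulVf ?expf_neq0 // scale1r.
by rewrite !add0r subr0 addrAC subrr add0r.
Qed.

(** Cancel [q - 1] between the counting formulas in two consecutive codimensions. This is the
    cancellation behind [graded_decomp]. *)
Lemma facets_above_recr y h : (y <= H)%VS -> h \in H -> h \notin y ->
  #|[pred B : subsp K n | facet H B && (y <= B)%VS]| =
  (#|K| * #|[pred B : subsp K n | facet H B && (y + <[h]> <= B)%VS]| + 1)%N.
Proof.
move=> yH hH hy; have q1 := cardK_gt1 K.
have yhH : (y + <[h]> <= H)%VS by rewrite subv_add yH -memvE.
have E1 := card_hyperplanes_above yH; have E2 := card_hyperplanes_above yhH.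
have lt_d : (\dim y < \dim H)%N.
  by rewrite -(dimv_addline hy) dimvS.
move: E1; rewrite (_ : \dim H - \dim y = (\dim H - \dim (y + <[h]>)).+1)%N; last first.
  by rewrite dimv_addline // subnSK.
rewrite expnS -E2; have aux a N1 N2 : (1 < a)%N ->
    ((a - 1) * N1 + 1 = a * ((a - 1) * N2 + 1))%N -> (N1 = a * N2 + 1)%N.
  case: a => // c c0; rewrite subn1 /= => E; have : (c * N1 = c * (c.+1 * N2 + 1))%N by lia.
  by move/eqP; rewrite eqn_pmul2l // => /eqP.
exact: aux.
Qed.

(** On subspaces of [H] only [restr] contributes. On [y + <[e + h0]>] all terms are combinations of
    the [y + <[e + h0 + h]>], and hyperplane counts remove every coefficient except where [h] is in
    [y]. *)
Lemma graded_decomp k : {in graded W k, forall f,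
  f = restr f + affavg H e (proj H e f) +
      \sum_(B | facet H B) (q ^+ \dim B)^-1 *:
        \sum_(h : 'rV[K]_n | h \in H) daffavg B h (dproj B h f)}.
Proof.
pose T : 'End(FL F K n) := restr + (affavg H e \o proj H e)%VF +
  \sum_(B | facet H B) (q ^+ \dim B)^-1 *:
        \sum_(h : 'rV[K]_n | h \in H) (daffavg B h \o dproj B h)%VF.
have TE f : T f = restr f + affavg H e (proj H e f) +
      \sum_(B | facet H B) (q ^+ \dim B)^-1 *:
        \sum_(h : 'rV[K]_n | h \in H) daffavg B h (dproj B h f).
  rewrite !add_lfunE comp_lfunE sum_lfunE; congr (_ + _); apply: eq_bigr => B _.
  rewrite scale_lfunE sum_lfunE; congr (_ *: _); apply: eq_bigr => h _.
  by rewrite comp_lfunE.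
move=> f fW; rewrite -TE -[LHS]id_lfunE; move: f fW; apply: graded_eq => x xW.
rewrite TE id_lfunE; move: x xW; clear T TE.
apply: sub_addline_ind => [x xH|y h0 yH h0H].
  rewrite restr_sub // proj_sub // linear0 addr0 big1 ?addr0 // => B _.
  rewrite big1 ?scaler0 // => h _.
  by rewrite dprojE !proj_sub // subrr linear0.
have dprojE0 B h : (B <= H)%VS -> h \in H -> dproj B h 'b_(y + <[e + h0]>) =
    (y <= B)%VS%:R *: (((h0 - h \in B)%:R - (h0 \in B)%:R) *: 'b_y).
  move=> BH hH; rewrite dprojE (proj_addline BH yH hH h0H).
  have := proj_addline BH yH (mem0v H) h0H; rewrite addr0 => ->.
  by rewrite subr0 -!mulnb !natrM -scalerBl -mulrBr scalerA.
rewrite restr_addline // add0r.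
have := proj_addline (subvv H) yH (mem0v H) h0H; rewrite addr0 => ->.
rewrite yH subr0 h0H scale1r.
pose G h := 'b_(y + <[e + h0 + h]>).
have avgH : affavg H e 'b_y = (q ^+ \dim H)^-1 *: \sum_(h : 'rV[K]_n | h \in H) G h.
  by rewrite -(affavg_shift _ _ h0H) affavgE.
have avgB B : (B <= H)%VS -> affavg B (e + h0) 'b_y =
   (q ^+ \dim B)^-1 *: \sum_(h : 'rV[K]_n | h \in H) (h \in B)%:R *: G h.
  move=> BH; rewrite affavgE; congr (_ *: _).
  rewrite [RHS](bigID (fun h => h \in B)) /= [X in _ = _ + X]big1 ?addr0.
    rewrite [RHS](eq_bigl (fun h => h \in B)).
      by apply: eq_bigr => h ->; rewrite scale1r.
    by move=> h; apply/andb_idl/subvP.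
  by move=> h /andP[_ /negPf ->]; rewrite scale0r.
have sumB B : facet H B -> (q ^+ \dim B)^-1 *:
     \sum_(h : 'rV[K]_n | h \in H) daffavg B h (dproj B h 'b_(y + <[e + h0]>)) =
     (y <= B)%VS%:R *: (affavg B (e + h0) 'b_y - affavg H e 'b_y).
  move=> /andP[BH /eqP dB].
  (* Averages over [B] shifted through [H] sum to a multiple of the average over [H]. Hence the part
     of [dproj] that does not depend on [h] drops out. *)
  have daff0 f : \sum_(h : 'rV[K]_n | h \in H) daffavg B h f = 0.
    under eq_bigr => h _ do rewrite daffavgE.
    rewrite sumrB -sum_lfunE sum_affavg // scale_lfunE.
    rewrite (eq_bigr (fun=> 1 *: affavg H e f)) => [|h _]; last by rewrite scale1r.
    by rewrite -scaler_suml card_subspF subrr.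
  rewrite (eq_bigr (fun h => (y <= B)%VS%:R *: ((h0 - h \in B)%:R *: daffavg B h 'b_y)
     - daffavg B h ((y <= B)%VS%:R *: ((h0 \in B)%:R *: 'b_y)))) => [|h hH]; last first.
    rewrite dprojE0 // scalerBl scalerBr linearB /=; congr (_ - _).
    by rewrite linearZ /= linearZ.
  rewrite sumrB daff0 subr0 -scaler_sumr scalerA mulrC -scalerA; congr (_ *: _).
  (* Only the coset [h0 + B] contributes. [daffavg B h] is constant on it, and its size cancels the
     normalisation. *)
  rewrite (bigID (fun h => h - h0 \in B)) /= [X in _ *: (_ + X)]big1 ?addr0; last first.
    by move=> h /andP[_ hB]; rewrite -opprB rpredN (negPf hB) scale0r.
  rewrite (eq_bigl (fun h => h - h0 \in B)) => [|h]; last first.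
    by apply: andb_idl => /(subvP BH) ?; rewrite -(subrK h0 h) rpredD.
  rewrite (eq_bigr (fun=> 1 *: (affavg B (e + h0) 'b_y - affavg H e 'b_y))) => [|h hB].
    rewrite -scaler_suml sum_coset card_subspF scalerA mulVf ?expf_neq0 //.
    by rewrite scale1r.
  rewrite -opprB rpredN hB !scale1r daffavgE.
  have -> : e + h = e + h0 + (h - h0) by rewrite addrACA subrr addr0.
  by rewrite affavg_shift.
rewrite (eq_bigr _ sumB) avgH.
pose N y := #|[pred B : subsp K n | facet H B && (y <= B)%VS]|.
have Nsum (P : pred (subsp K n)) (T : lmodType F) (v : T) :
    \sum_(B | facet H B) (P B)%:R *: v = #|[pred B | facet H B && P B]|%:R *: v.
  rewrite -scaler_suml -sum1_card natr_sum; congr (_ *: _).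
  transitivity (\sum_(B | facet H B && P B) (1 : F)); last exact: eq_bigl.
  by rewrite [RHS]big_mkcondr; apply: eq_bigr => B _; case: (P B).
have -> : \sum_(B | facet H B) (y <= B)%VS%:R *: (affavg B (e + h0) 'b_y -
     (q ^+ \dim H)^-1 *: \sum_(h : 'rV[K]_n | h \in H) G h) =
  \sum_(h : 'rV[K]_n | h \in H)
    ((q ^+ (\dim H))^-1 * (q * (N (y + <[h]>)%VS)%:R - (N y)%:R)) *: G h.
  under eq_bigr => B _ do rewrite scalerBr.
  rewrite sumrB Nsum scalerA scaler_sumr.
  rewrite (eq_bigr (fun B => \sum_(h : 'rV[K]_n | h \in H)
     ((y + <[h]> <= B)%VS)%:R *: ((q * (q ^+ \dim H)^-1) *: G h)))
    => [|B /andP[BH /eqP dB]]; last first.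
    rewrite avgB // !scaler_sumr; apply: eq_bigr => h hH.
    rewrite subv_add -memvE -mulnb natrM -dB exprS invfM mulrA divff // mul1r.
    by rewrite !scalerA mulrAC -mulrA.
  rewrite exchange_big -sumrB /=; apply: eq_bigr => h hH.
  rewrite Nsum scalerA -scalerBl; congr (_ *: _).
  by rewrite -!/(N _); ring.
rewrite scaler_sumr -big_split /=.
(* The coefficient of [G h] is [1 + q * N (y + <[h]>) - N y] divided by [q ^+ \dim H]. It vanishes
   for [h] outside [y] by [facets_above_recr], and is [(q ^+ \dim y)^-1] for [h] in [y] by the
   hyperplane count. *)
rewrite (eq_bigr (fun h => (h \in y)%:R *: ((q ^+ \dim y)^-1 *: 'b_(y + <[e + h0]>)))) => [|h hH].
  rewrite -scaler_suml (bigID (fun h => h \in y)) /= [X in _ = (_ + X) *: _]big1 ?addr0; last first.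
    by move=> h /andP[_ /negPf ->].
  rewrite (eq_bigl (fun h => h \in y)) => [|h]; last by apply/andb_idl/subvP.
  rewrite (eq_bigr (fun=> 1)) => [|h ->//].
  by rewrite card_subspF scalerA mulfV ?expf_neq0 // scale1r.
rewrite -scalerDl; have [hy | hy] := boolP (h \in y); last first.
  rewrite scale0r {2}/N (facets_above_recr yH hH hy) -/(N _) natrD natrM.
  by rewrite [X in X *: _](_ : _ = 0) ?scale0r //; ring.
have uH : e + h0 \notin H by rewrite notin_shift.
rewrite /G (addline_shift yH) // scale1r; congr (_ *: _).
have -> : (y + <[h]>)%VS = y by apply/addv_idPl; rewrite -memvE.
have := congr1 (fun a => a%:R : F) (card_hyperplanes_above yH).
rewrite natrD natrM natrB ?(ltnW (cardK_gt1 K)) // natrX => NE.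
apply: (mulfI (expf_neq0 (\dim H) q_neq0)); rewrite mulrDr mulfV ?expf_neq0 // mulVKf ?expf_neq0 //.
rewrite -(subnK (dimvS yH)) exprD mulfK ?expf_neq0 // -NE /N; ring.
Qed.

End Hyperplane.
Lemma qintD i j : qint F #|K| (i + j) = qint F #|K| i + q ^+ i * qint F #|K| j.
Proof.
elim: j => [|j IHj]; first by rewrite addn0 qint0 mulr0 addr0.
by rewrite addnS !qintS IHj mulrDr exprD addrA.
Qed.

Lemma basis_neq0 x : 'b_x != 0.
Proof.
by apply/eqP => /ffunP/(_ x)/eqP; rewrite !ffunE eqxx oner_eq0.
Qed.

(** * Homology of the powers of the incidence map *)

Section QuantumCharacteristic.
Variable m : nat.
Hypotheses (qm0 : qint F #|K| m = 0) (qi_neq0 : forall i, (0 < i < m)%N -> qint F #|K| i != 0).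

Theorem incidence_exact W : exact_outside Dp (graded W) m (\dim W)%:Z.
Proof.
have [d] := ubnP (\dim W); elim: d W => // d IHd W Wd k i f im kW fW Df.
have [W0 | W_gt0] := posnP (\dim W).
  (* For zero [W], [k = 0] would put the index value m - i strictly between 0 and [m], against [kW];
     so degree [k] is empty. *)
  have -> : f = 0 by apply: graded_out fW; rewrite W0; lia.
  by exists 0; rewrite ?mem0v ?linear0.
have [H [e [eH WE]]] := hyperplane_exists W_gt0; subst W.
have dW := dimv_addline eH; rewrite dW in kW Wd.
have exH := IHd H Wd.
(* Membership in the image is additive, so the summands of [graded_decomp] can be lifted
   separately. *)
suff /memv_imgP[g gW ->] :
  f \in (Dp (m - i) @: graded (H + <[e]>) (k + m%:Z - i%:Z))%VS by exists g.
rewrite (graded_decomp eH fW) rpredD //.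
  have [Ea Eb] := restr_proj_incidence_pow eH i fW.
  have bH : proj H H e f \in graded H (k - 1).
    by rewrite -[e]addr0 (proj_graded eH) ?mem0v.
  have Db : Dp i (proj H H e f) = 0.
    move/esym/eqP: Eb; rewrite Df linear0 scaler_eq0 expf_eq0 (negPf q_neq0) andbF.
    by move/eqP.
  have [||||||||||a [b [aH bH' Ea' Eb']]] := exact_cone (@incidence_pow0) incidence_powD
    (@graded_incidence_pow H) exH (k := k) (i := i) (r := q ^+ (m - i))
    (a := restr H f) (b := proj H H e f) (c := qint F #|K|); try by [].
  - exact: qi_neq0.
  - by apply: qi_neq0; lia.
  - by rewrite expf_neq0.
  (* This is $q^{m-i}[i]_q+[m-i]_q=[m]_q=0$. *)
  - by rewrite addrC -qintD subnK // ltnW //; case/andP: im.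
  - by move: kW; rewrite intS [1 + _]addrC.
  - exact: restr_graded fW.
  - by rewrite -Ea Df linear0.
  apply/memv_imgP; exists (a + affavg H e b).
    apply: rpredD; first exact: (subvP (graded_sub _ (addvSl _ _)) a aH).
    have -> : k + m%:Z - i%:Z = k - 1 + m%:Z - i%:Z + 1 by lia.
    apply: affavg_graded bH' => //; first exact: addvSl.
    by rewrite (subvP (addvSr _ _)) ?memv_line.
  rewrite linearD /= (incidence_pow_affavg _ (subvv H) eH bH') addrA Ea'.
  by rewrite -linearZ /= Eb'.
apply: rpred_sum => B HB; apply: rpredZ; apply: rpred_sum => h hH.
have /andP[BH /eqP dB] := HB.
(* From (W, k) to (B, k - 1), twice the degree and the dimension both drop by 2, so the index stays
   outside the middle range. *)
have [||||g gB <-] := IHd B _ (k - 1) i (dproj H e B h f) im; first by lia.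
- by move: kW; rewrite -dB; case/orP=> kB; apply/orP; [left|right]; lia.
- exact: dproj_graded.
- apply: (scalerI (expf_neq0 i q_neq0)).
  by rewrite -(dproj_incidence_pow eH i HB hH fW) Df linear0 scaler0.
apply/memv_imgP; exists ((q ^+ (m - i))^-1 *: daffavg H e B h g).
  rewrite rpredZ //; have -> : k + m%:Z - i%:Z = k - 1 + m%:Z - i%:Z + 1 by lia.
  exact: daffavg_graded.
rewrite linearZ /= (daffavg_incidence_pow eH _ BH hH gB) scalerA mulVf ?expf_neq0 //.
by rewrite scale1r.
Qed.

(** Induction in steps of codimension 2: [daffavg] carries a cycle that is not a boundary from [B]
    to [W], and [dproj] would carry any preimage of it back to [B]. *)
Theorem incidence_not_exact W (k : int) i : 0 <= k <= (\dim W)%:Z -> (0 < i < m)%N ->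
    (\dim W)%:Z < k *+ 2 + m%:Z - i%:Z < (\dim W)%:Z + m%:Z ->
  exists f, [/\ f \in graded W k, Dp i f = 0 &
    forall g, g \in graded W (k + m%:Z - i%:Z) -> Dp (m - i) g <> f].
Proof.
have [d] := ubnP (\dim W); elim: d W k => // d IHd W k Wd kW im kmid.
have single x : (x <= W)%VS -> (\dim x)%:Z = k -> k - i%:Z < 0 ->
    (\dim W)%:Z < k + m%:Z - i%:Z -> exists f, [/\ f \in graded W k, Dp i f = 0 &
    forall g, g \in graded W (k + m%:Z - i%:Z) -> Dp (m - i) g <> f].
  move=> xW xk ki kmi; have bW : 'b_x \in graded W k by rewrite -xk graded_basis.
  exists 'b_x; split=> // [|g gW].
    by apply: graded_out (graded_incidence_pow i bW); lia.
  have -> : g = 0 by apply: graded_out gW; lia.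
  by rewrite linear0 => /esym/eqP; rewrite (negPf (basis_neq0 x)).
(* In the middle range [k = 0] forces [\dim W] below m - i, and [k = \dim W] forces it below [i];
   either way both neighbouring terms are zero. In the remaining degrees [W] has dimension at least
   2, so [B] exists. *)
have [k0 | k0] := eqVneq k 0.
  by apply: (single 0%VS); rewrite ?sub0v ?dimv0; lia.
have [kd | kd] := eqVneq k (\dim W)%:Z.
  by apply: (single W) => //; lia.
have [H [e [eH WE]]] : exists (H : subsp K n) e, e \notin H /\ W = (H + <[e]>)%VS.
  by apply: hyperplane_exists; lia.
subst W; have dW := dimv_addline eH; rewrite dW in kW Wd kmid kd.
have [B [h [hB HE]]] : exists (B : subsp K n) h, h \notin B /\ H = (B + <[h]>)%VS.
  by apply: hyperplane_exists; lia.
have dH : \dim H = (\dim B).+1 by rewrite HE dimv_addline.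
have HB : facet H B by rewrite /facet dH eqxx andbT HE addvSl.
have hH : h \in H by rewrite HE (subvP (addvSr _ _)) ?memv_line.
have /andP[BH _] := HB.
have [||||f [fB Df fim]] := IHd B (k - 1); try by lia.
exists (daffavg H e B h f); split=> [||g gW gE].
- by rewrite -[k](subrK 1) daffavg_graded.
- by rewrite (daffavg_incidence_pow eH _ BH hH fB) Df linear0 scaler0.
apply: (fim (q ^+ (m - i) *: dproj H e B h g)).
  rewrite rpredZ //; have -> : k - 1 + m%:Z - i%:Z = k + m%:Z - i%:Z - 1 by lia.
  exact: dproj_graded.
rewrite linearZ /= -(dproj_incidence_pow eH _ HB hH gW) gE.
exact: (dprojK eH HB hH hB fB).
Qed.

End QuantumCharacteristic.
End Operators.

(** * The incidence sequences *)

Section Sequences.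
Variables (F : fieldType) (V : vectType F).

Lemma same_seq_exact_at (C E : vseq V) s t :
    (forall t, term C t = term E (t + s) /\ {in term C t, smap C t =1 smap E (t + s)}) ->
  exact_at C t -> exact_at E (t + s).
Proof.
move=> CE; rewrite /exact_at /cycles /boundaries.
have -> : t + s + 1 = t + 1 + s by rewrite addrAC.
have [<- mE] := CE t; have [<- mE'] := CE (t + 1) => ex.
transitivity (term C t :&: lker (smap C t))%VS.
  apply/vspaceP => v; rewrite !memv_cap; case: (boolP (v \in term C t)) => //= vC.
  by rewrite !memv_ker mE.
by rewrite ex; apply/eq_in_limg.
Qed.

End Sequences.

Section Position.
Variables (m i : nat) (k : int).
Hypothesis im : (0 < i < m)%N.

Lemma Mseq_powP (t : int) : (0 < Mseq_pow m i t < m)%N.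
Proof. by rewrite /Mseq_pow; case: ifP; lia. Qed.

Lemma Mseq_powS (t : int) : Mseq_pow m i (t + 1) = (m - Mseq_pow m i t)%N.
Proof. by rewrite /Mseq_pow; do 2! case: ifP; lia. Qed.

Lemma Mseq_dimS (t : int) :
  Mseq_dim m k i (t + 1) = Mseq_dim m k i t + m%:Z - (Mseq_pow m i t)%:Z.
Proof.
rewrite /Mseq_dim /Mseq_pow; case: ifP => t1; case: ifP => t0; try lia.
  have -> : ((t + 1) %/ 2)%Z = (t %/ 2)%Z + 1 by lia.
  by rewrite mulrDl mul1r; lia.
have -> : ((t + 1) %/ 2)%Z = (t %/ 2)%Z by lia.
lia.
Qed.

(** Each step adds [m] to the quantity that a middle index confines to an open interval of length
    [m]; this is the source of almost exactness. *)
Lemma Mseq_center (t : int) : Mseq_dim m k i t *+ 2 + m%:Z - (Mseq_pow m i t)%:Z =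
  k *+ 2 + m%:Z - i%:Z + t * m%:Z.
Proof.
rewrite /Mseq_dim /Mseq_pow; case: ifP => t0.
  have {2}-> : t = (t %/ 2)%Z * 2 by lia.
  lia.
have {2}-> : t = (t %/ 2)%Z * 2 + 1 by lia.
lia.
Qed.

Lemma Mseq_shift (t s : int) :
  Mseq_dim m (Mseq_dim m k i t) (Mseq_pow m i t) s = Mseq_dim m k i (s + t) /\
  Mseq_pow m (Mseq_pow m i t) s = Mseq_pow m i (s + t).
Proof.
rewrite /Mseq_dim /Mseq_pow; split; last by do 3! case: ifP; lia.
(* Halving is additive up to a carry of 1 when [s] and [t] are both odd. *)
have -> : ((s + t) %/ 2)%Z =
    (s %/ 2)%Z + (t %/ 2)%Z + (~~ (2 %| s)%Z && ~~ (2 %| t)%Z)%:Z by lia.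
rewrite !mulrDl; case: (boolP (2 %| t)%Z) => t0; case: (boolP (2 %| s)%Z) => s0;
  case: ifP => st0 /=; lia.
Qed.

Lemma Mseq_same (F : fieldType) (K : finFieldType) n (t : int) :
  same_seq (Mseq F K n m k i)
           (Mseq F K n m (Mseq_dim m k i t) (Mseq_pow m i t)).
Proof.
exists (- t) => s; have [E1 E2] := Mseq_shift t (s - t).
by rewrite /= E1 E2 subrK.
Qed.

End Position.

Lemma M_graded F (K : finFieldType) n k : M F K n k = graded F (fullv : subsp K n) k.
Proof.
by congr (<<_>>%VS); apply: eq_image => // x; rewrite !inE subvf.
Qed.

(** * Exactness at a single position *)

Section Main.
Variables (F : fieldType) (K : finFieldType) (n m : nat).
Hypotheses (q_neq0 : #|K|%:R != 0 :> F) (m_gt0 : (0 < m)%N).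
Hypotheses (qm0 : qint F #|K| m = 0)
  (qi_neq0 : forall i, (0 < i < m)%N -> qint F #|K| i != 0).

Definition middleb (k : int) (i : nat) : bool :=
  [&& 0 <= k <= n%:Z, (0 < i < m)%N & n%:Z < k *+ 2 + m%:Z - i%:Z < n%:Z + m%:Z].

Lemma middleP k i : reflect (middle_index m n k i) (middleb k i).
Proof. exact: and3P. Qed.

(** In degrees from 0 to [n] the two preceding theorems decide, with [W] the full space; other terms
    are zero. Boundaries are cycles because the [m]-th power of the incidence map vanishes. *)
Lemma exact_at_middle k i (t : int) : (0 < i < m)%N ->
  exact_at (Mseq F K n m k i) t <-> ~~ middleb (Mseq_dim m k i t) (Mseq_pow m i t).
Proof.
move=> im; have tm := Mseq_powP im t.
rewrite /exact_at /cycles /boundaries /= Mseq_dimS // Mseq_powS // !M_graded.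
move: (Mseq_dim m k i t) (Mseq_pow m i t) tm => {}k {}i {}im.
have dn : \dim (fullv : subsp K n) = n by rewrite dimvf /dim /= mul1n.
split=> [E | mid].
  apply/negP => /and3P[k0 _ kmid]; rewrite -dn in k0 kmid.
  have [f [fG Df fim]] := incidence_not_exact q_neq0 k0 im kmid.
  have : f \in (graded F fullv k :&: lker (incidence_pow F K n i))%VS.
    by rewrite memv_cap fG memv_ker Df /=.
  by rewrite E => /memv_imgP[g gG fE]; apply: (fim g gG).
apply/eqP; rewrite eqEsubv; apply/andP; split; apply/subvP => f.
  rewrite memv_cap memv_ker => /andP[fG /eqP Df].
  have [kn | kn] := boolP (0 <= k <= n%:Z); last first.
    by rewrite (graded_out _ fG) ?mem0v // dn; apply/negP.
  have [||//|//|g gG <-] := incidence_exact q_neq0 qm0 qi_neq0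
    (W := fullv) (k := k) (i := i) (f := f) => //.
    by rewrite dn; move: mid; rewrite /middleb kn im /=; lia.
  by apply/memv_imgP; exists g.
case/memv_imgP => g gG ->; rewrite memv_cap memv_ker -incidence_powD.
rewrite subnKC; last by case/andP: im => _ /ltnW.
rewrite (incidence_pow_eq0 q_neq0 qm0 m_gt0 gG) eqxx andbT.
have := graded_incidence_pow (m - i) gG.
by have -> : k + m%:Z - i%:Z - (m - i)%N%:Z = k by lia.
Qed.

End Main.

Theorem corollary4p2 (F : fieldType) (p q : nat) (K : finFieldType)
  (pF : p \in [pchar F]) (cardK : #|K| = q) (npq : ~~ (p %| q)%N)
  (m : nat) (mE : m = qchar pF npq) (n : nat) (k : int) (i : nat)
  (hi : (0 < i < m)%N) :
  almost_exact (Mseq F K n m k i) /\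
  (exact_seq (Mseq F K n m k i) <->
   forall (k' : int) (i' : nat), (0 < i' < m)%N ->
     same_seq (Mseq F K n m k i) (Mseq F K n m k' i') ->
     ~ middle_index m n k' i').
Proof.
have q_neq0 : #|K|%:R != 0 :> F by rewrite cardK -(dvdn_pcharf pF).
have m_gt0 : (0 < m)%N by lia.
have [qm0 qi_neq0] : qint F #|K| m = 0 /\
    forall j, (0 < j < m)%N -> qint F #|K| j != 0.
  rewrite cardK mE /qchar; case: ex_minnP => m' /andP[_ /eqP ->] min_m'.
  split=> // j /andP[j_gt0 jm']; apply/eqP => qj0.
  (* Minimality of [m] concerns only indices above 1; $[1]_q=1$ is handled directly. *)
  have [j1 | j1] := eqVneq j 1%N.
    by move/eqP: qj0; rewrite j1 /qint big_ord1 expr0 oner_eq0.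
  by have := min_m' j; rewrite qj0 eqxx andbT; lia.
have exE := exact_at_middle n q_neq0 m_gt0 qm0 qi_neq0.
split=> [t1 t2 ex1 ex2 | ].
  have mid t : ~ exact_at (Mseq F K n m k i) t ->
      n%:Z < k *+ 2 + m%:Z - i%:Z + t * m%:Z < n%:Z + m%:Z.
    move=> ex; rewrite -(Mseq_center k hi).
    have [/and3P[]//|mid] := boolP (middleb n m (Mseq_dim m k i t) (Mseq_pow m i t)).
    by case: ex; apply/(exE k i t hi).
  have [/andP[a1 b1] /andP[a2 b2]] := (mid _ ex1, mid _ ex2).
  have m0 : 0 < m%:Z by lia.
  (* Both values lie in an open interval of length [m] and differ by a multiple of [m], so the
     positions agree. *)
  have lt12 (u v : int) : n%:Z < k *+ 2 + m%:Z - i%:Z + u * m%:Z ->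
      k *+ 2 + m%:Z - i%:Z + v * m%:Z < n%:Z + m%:Z -> v < u + 1.
    move=> nu nv; rewrite -(ltr_pM2r m0) mulrDl mul1r; lia.
  by have := lt12 _ _ a1 b2; have := lt12 _ _ a2 b1; lia.
split=> [ex k' i' i'm [s CE] /middleP mid | nomid t].
  (* Position [- s] corresponds to position 0 of the second sequence, where the index is (k',
     i'). *)
  have := same_seq_exact_at CE (ex (- s)); rewrite addNr.
  have [D0 P0] : Mseq_dim m k' i' 0 = k' /\ Mseq_pow m i' 0 = i'.
    by rewrite /Mseq_dim /Mseq_pow /= div0z mul0r !addr0.
  by move/(exE _ _ _ i'm); rewrite D0 P0 mid.
(* The index read off at position [t] defines the same sequence, so [nomid] applies to it. *)
apply/(exE _ _ _ hi)/middleP; apply: nomid (Mseq_powP hi t) _.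
exact: Mseq_same.
Qed.
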